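(* Let $I\subset S=K[x_1,\dots,x_n]$ be a monomial ideal with $\operatorname{Ass}(S/I)=\{P_1,\dots,P_m\}$ (the $P_i$ pairwise distinct), and suppose that $G(P_i)\cap G(P_j)=\emptyset$ for all $i\ne j$. Then $\operatorname{sdepth}(I)\ge m$. In particular, Stanley's conjecture holds for $I$, i.e. $\operatorname{depth}_S(I)\le\operatorname{sdepth}_S(I)$.
   Context: $K$ is a field and $S=K[x_1,\dots,x_n]$ is the polynomial ring, with its standard $\mathbb{Z}^n$-grading. $G(J)$ denotes the set of minimal monomial generators of a monomial ideal $J$ (for a monomial prime ideal, the set of variables generating it; associated primes of monomial ideals are monomial primes). Let $M$ be a finitely generated $\mathbb{Z}^n$-graded $S$-module. For a homogeneous $u\in M$ and a subset $Z\subset\{x_1,\dots,x_n\}$, $uK[Z]$ denotes the $K$-subspace of $M$ generated by all $uv$, $v$ a monomial in $K[Z]$; if $uK[Z]$ is a free $K[Z]$-module it is called a Stanley space of dimension $|Z|$. A Stanley decomposition of $M$ is a presentation of $M$ as a finite direct sum of $\mathbb{Z}^n$-graded $K$-vector spaces $\mathcal{D}: M=\bigoplus_{i=1}^{s}u_iK[Z_i]$ with each $u_iK[Z_i]$ a Stanley space; $\operatorname{sdepth}\mathcal{D}=\min_i|Z_i|$, and $\operatorname{sdepth} M=\operatorname{sdepth}_S M$ is the maximum of $\operatorname{sdepth}\mathcal{D}$ over all Stanley decompositions $\mathcal{D}$ of $M$. Stanley's conjecture for $M$ is the inequality $\operatorname{depth} M\le\operatorname{sdepth} M$. *)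

(* Defs.v *)
From Stdlib Require Export ClassicalEpsilon.
From mathcomp Require Export all_boot all_order all_algebra.
From mathcomp.multinomials Require Export mpoly.

Set Implicit Arguments.
Unset Strict Implicit.
Unset Printing Implicit Defensive.

Import GRing.Theory.

Local Open Scope ring_scope.

(** Extended naturals [0, 1, ..., oo], with [None] standing for [oo].  They are
    needed only because the zero module has infinite depth and Stanley depth. *)

Definition enat : Type := option nat.

Definition enat_le (x y : enat) : bool :=
  match x, y with
  | _, None => true
  | None, Some _ => false
  | Some a, Some b => (a <= b)%N
  end.

Definition enat_min (x y : enat) : enat := if enat_le x y then x else y.

Definition enat_lub (A : enat -> Prop) (s : enat) : Prop :=
  (forall x, A x -> enat_le x s) /\
  (forall t, (forall x, A x -> enat_le x t) -> enat_le s t).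

Definition enat_sup (A : enat -> Prop) : enat :=
  epsilon (inhabits None) (enat_lub A).

Lemma enat_supP (A : enat -> Prop) : enat_lub A (enat_sup A).
Proof.
apply: (epsilon_spec (inhabits None)).
case: (excluded_middle_informative
         (exists b : nat, forall x, A x -> enat_le x (Some b))); last first.
  move=> unb; exists None; split=> [[]//|[b|//] ubb].
  by case: unb; exists b.
case=> b; elim: b => [|b IHb] ub.
  by exists (Some 0%N); split=> // -[].
case: (excluded_middle_informative (forall x, A x -> enat_le x (Some b))).
  exact: IHb.
move=> nub; exists (Some b.+1); split=> // -[t|//] ubt /=.
rewrite ltnNge; apply/negP => le_tb; apply: nub => x /ubt.
by case: x => //= a le_at; apply: leq_trans le_tb.
Qed.

Section Ideals.

Variables (K : fieldType) (n : nat).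
Local Notation S := {mpoly K[n]}.

Implicit Types (I J P Q : {pred S}) (f g u v : S) (Z : {set 'I_n}).

Definition ideal_span (G : S -> Prop) f : Prop :=
  exists2 s : seq (S * S),
    forall p, p \in s -> G p.2 & f = \sum_(p <- s) p.1 * p.2.

Definition monomial_ideal I : Prop :=
  exists A : 'X_{1..n} -> Prop,
    forall f, f \in I <-> ideal_span (fun g => exists2 a, A a & g = 'X_[a]) f.

Definition min_mon_gens J (a : 'X_{1..n}) : Prop :=
  'X_[a] \in J /\ forall b : 'X_{1..n}, 'X_[b] \in J -> (b <= a)%MM -> b = a.

Definition prime_ideal P : Prop := idealr_closed P /\ prime_idealr_closed P.

(** [P] is the annihilator [I : f] of the class of some [f] in [S / I]. *)
Definition associated_prime I P : Prop :=
  prime_ideal P /\ exists f, forall g, (g \in P) = (g * f \in I).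

(** Homogeneous for the [Z^n]-grading of [S]: scalar multiple of a monomial. *)
Definition multihomogeneous u : Prop :=
  exists (c : K) (a : 'X_{1..n}), u = c *: 'X_[a].

Definition in_subring Z v : Prop :=
  forall a, a \in msupp v -> forall k, k \notin Z -> a k = 0%N.

(** [u K[Z]]; it is free over [K[Z]] with basis [u] when [stanley_free u Z]
    holds, which excludes [u = 0]. *)
Definition stanley_subspace u Z f : Prop :=
  exists2 v, in_subring Z v & f = u * v.

Definition stanley_free u Z : Prop :=
  forall v, in_subring Z v -> u * v = 0 -> v = 0.

Definition stanley_decomposition I (s : nat)
    (u : 'I_s -> S) (Z : 'I_s -> {set 'I_n}) : Prop :=
  [/\ forall i, [/\ u i \in I, multihomogeneous (u i) & stanley_free (u i) (Z i)],
      forall f, f \in I <->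
        exists2 w : 'I_s -> S,
          forall i, stanley_subspace (u i) (Z i) (w i) & f = \sum_i w i
    & forall w : 'I_s -> S,
        (forall i, stanley_subspace (u i) (Z i) (w i)) ->
        \sum_i w i = 0 -> forall i, w i = 0].

Definition sdepth_decomposition (s : nat) (Z : 'I_s -> {set 'I_n}) : enat :=
  \big[enat_min/None]_(i < s) Some #|Z i|.

(** The supremum is a maximum: the Stanley depth of a decomposition is [oo] (for
    the empty decomposition of the zero ideal) or at most [n]. *)
Definition sdepth I : enat :=
  enat_sup (fun d =>
    exists s (u : 'I_s -> S) (Z : 'I_s -> {set 'I_n}),
      stanley_decomposition I u Z /\ d = sdepth_decomposition Z).

(** The submodule [(f_1, ..., f_r) I] of [I], for [fs = [:: f_1; ...; f_r]]. *)
Definition seq_mul_ideal (fs : seq S) I : S -> Prop :=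
  ideal_span (fun h => exists f g, [/\ f \in fs, g \in I & h = f * g]).

Definition irrelevant_ideal : S -> Prop :=
  ideal_span (fun g => exists i : 'I_n, g = 'X_i).

(** [fs] is a regular sequence on the [S]-module [I], contained in the graded
    maximal ideal. *)
Definition regular_sequence I (fs : seq S) : Prop :=
  [/\ forall f, f \in fs -> irrelevant_ideal f,
      forall r, (r < size fs)%N -> forall g, g \in I ->
        seq_mul_ideal (take r fs) I (fs`_r * g) ->
        seq_mul_ideal (take r fs) I g
    & exists2 g, g \in I & ~ seq_mul_ideal fs I g].

Definition depth I : enat :=
  if excluded_middle_informative (forall f, f \in I -> f = 0) then None
  else enat_sup (fun d =>
    exists2 fs, regular_sequence I fs & d = Some (size fs)).

End Ideals.

(* Main.v *)
Require Import Defs.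
From mathcomp Require Import zify.

Set Implicit Arguments.
Unset Strict Implicit.
Unset Printing Implicit Defensive.

Import GRing.Theory.

(** The proof is about the set [U] of exponents of the monomials in [I], which
    is closed upwards.  If [I] is zero its Stanley depth is infinite, so let [U]
    be nonempty.

    Dickson's lemma gives [N] such that membership in [U] only depends on the
    exponents truncated at [N].  A corner is a maximal exponent [b <= N]
    outside [U]; write [Z(b)] for the set of the [k] with [b k < N].  Then [a]
    is outside [U] iff [a <= b] on [Z(b)] for some corner [b], and
    [I : 'X_[b]] is the monomial prime generated by the variables in [Z(b)].
    So every [Z(b)] is the variable set of an associated prime; by hypothesis
    these nonempty sets are pairwise equal or disjoint.  Choose one variable in
    each of them, add the variables that lie in none, and let [T] be the
    resulting set.  All three quantities are compared with [#|T|].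

    - [#|T| <= sdepth I].  Fix the exponents outside [T].  For each corner [b],
      the condition [a <= b] on [Z(b)] then either fails or bounds the single
      remaining exponent in [T] that meets [Z(b)], so the points of [U] that
      remain form an orthant [threshold + N^T].  Grouping the fixed exponents
      by their truncation at [N] leaves finitely many orthants, of dimension at
      least [#|T|]: a Stanley decomposition ([sdepth_bound]).

    - [m <= #|T|].  The product of the ['X_t ^+ N] over [T] lies in [I], hence
      in each [P i]; so each [P i] contains a variable in [T], and distinct
      [P i] share no variable.

    - [depth I <= #|T|].  A regular sequence of length [d] on [I] kills the
      Koszul homology of the variables with coefficients in [I] in degrees
      above [n - d] ([koszul_acyclic]).  But degree [n - #|T|] carries a
      nonzero class ([regular_sequence_bound]): up to a monomial it is the
      wedge product, over the sets [Z(b)], of the Koszul boundaries of the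
      wedge of the variables in [Z(b)].  For [I] a product of primes this is
      the product of the classes of the factors. *)

(** * Truncation of exponents *)

Section Exponents.

Variable n : nat.
Implicit Types (a b c : 'X_{1..n}) (U : 'X_{1..n} -> Prop) (k : 'I_n).

Definition upset U : Prop := forall a b, (a <= b)%MM -> U a -> U b.

Definition mnm_trunc N a : 'X_{1..n} := [multinom minn (a k) N | k < n].

Definition mnm_upd k (t : nat) a : 'X_{1..n} :=
  [multinom if j == k then t else a j | j < n].

(** Dickson's lemma in the form of a truncation bound, for sets that only
    depend on the coordinates listed in [D].  The slices of [U] at a fixed
    [k]-th coordinate are upward closed and increase with that coordinate; their
    union is truncated at some [M] by induction, and is already attained by one
    slice. *)
Lemma upset_trunc_on (D : seq 'I_n) U :
    upset U -> (forall a b, {in D, a =1 b} -> U a -> U b) ->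
  exists N, forall a, U a -> U (mnm_trunc N a).
Proof.
elim: D U => [|k D IHD] U upU UD.
  by exists 0 => a; apply: UD.
have slice_up t : upset (fun a => U (mnm_upd k t a)).
  move=> a b /mnm_lepP le_ab; apply: upU; apply/mnm_lepP => j.
  by rewrite !mnmE; case: eqP.
have sliceD a b t s : (t <= s) -> {in D, a =1 b} ->
    U (mnm_upd k t a) -> U (mnm_upd k s b).
  move=> le_ts eqab /(slice_up _ _ _ (lepm_refl _)) Ua.
  have {Ua} : U (mnm_upd k s a).
    apply: upU Ua; apply/mnm_lepP => j; rewrite !mnmE.
    by case: eqP.
  apply: UD => j; rewrite !inE !mnmE; case: eqP => //= _.
  exact: eqab.
have [M HM] : exists M, forall a, (exists t, U (mnm_upd k t a)) ->
    exists t, U (mnm_upd k t (mnm_trunc M a)).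
  apply: IHD => [a b leab [t Ut]|a b eqab [t Ut]]; exists t.
    exact: slice_up Ut.
  exact: sliceD eqab Ut.
(* The box of side [M] is finite, so one height [t0] serves all its points. *)
have [t0 Ht0] : exists t0, forall a, (exists t, U (mnm_upd k t a)) ->
    U (mnm_upd k t0 (mnm_trunc M a)).
  pose pt (c : {ffun 'I_n -> 'I_M.+1}) := [multinom (c j : nat) | j < n].
  have /fin_all_exists[f Hf] (c : {ffun 'I_n -> 'I_M.+1}) : exists t,
      (exists t', U (mnm_upd k t' (pt c))) -> U (mnm_upd k t (pt c)).
    case: (excluded_middle_informative (exists t', U (mnm_upd k t' (pt c)))).
      by case=> t Ut; exists t.
    by exists 0.
  exists (\max_c f c) => a /HM.
  have -> : mnm_trunc M a = pt [ffun j => inord (minn (a j) M)].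
    apply/mnmP => j; rewrite !mnmE ffunE inordK //.
    by rewrite ltnS geq_minr.
  set c := finfun _ => /Hf; apply: sliceD => //.
  exact: leq_bigmax.
have /fin_all_exists[f Hf] (t : 'I_t0.+1) : exists N, forall a,
    U (mnm_upd k t a) -> U (mnm_upd k t (mnm_trunc N a)).
  by apply: IHD => // a b; apply: sliceD.
exists (maxn (maxn M t0) (\max_t f t)) => a Ua.
have eqa : mnm_upd k (a k) a = a.
  by apply/mnmP => j; rewrite mnmE; case: eqP => [->|].
have [le_at|lt_ta] := leqP (a k) t0.
  have := Hf (Ordinal (le_at : a k < t0.+1)) a; rewrite /= eqa => /(_ Ua).
  set t := Ordinal _; apply: upU; apply/mnm_lepP => j; rewrite !mnmE.
  have : f t <= \max_s f s by exact: leq_bigmax.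
  by case: (j =P k) => [->|_] /=; lia.
have /Ht0 : exists t, U (mnm_upd k t a) by exists (a k); rewrite eqa.
apply: upU; apply/mnm_lepP => j; rewrite !mnmE.
by case: (j =P k) => [->|_] /=; lia.
Qed.

Lemma upset_trunc U : upset U -> exists N, forall a, U (mnm_trunc N a) <-> U a.
Proof.
move=> upU; have [|N HN] := @upset_trunc_on (enum 'I_n) U upU.
  move=> a b eqab; have -> // : a = b.
  by apply/mnmP => k; apply: eqab; rewrite mem_enum.
exists N => a; split=> [|/HN//]; apply: upU.
by apply/mnm_lepP => k; rewrite mnmE geq_minl.
Qed.

End Exponents.

(** * Monomial ideals *)

Section MonomialIdeal.
Local Open Scope ring_scope.
Variables (K : fieldType) (n : nat).
Local Notation S := {mpoly K[n]}.
Implicit Types (f g h : S) (a b : 'X_{1..n}).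

(** Ideals as propositional predicates, possibly improper: the ideals
    [(f_1, ..., f_r) I] have no boolean membership test. *)
Record submodule (J : S -> Prop) : Prop := Submodule {
  submod0 : J 0;
  submodD : forall f g, J f -> J g -> J (f + g);
  submodM : forall h f, J f -> J (h * f)
}.

Lemma submod_sum (J : S -> Prop) (T : Type) (r : seq T) (P : pred T) (F : T -> S) :
  submodule J -> (forall i, P i -> J (F i)) -> J (\sum_(i <- r | P i) F i).
Proof. by move=> [J0 JD _] JF; apply: (big_ind J). Qed.

Lemma submodB (J : S -> Prop) f g : submodule J -> J f -> J g -> J (f - g).
Proof.
by move=> [_ JD JM] Jf Jg; apply: JD => //; rewrite -mulN1r; apply: JM.
Qed.

Lemma ideal_span_submod (G : S -> Prop) : submodule (ideal_span G).
Proof.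
split=> [|_ _ [s sG ->] [t tG ->]|h _ [s sG ->]].
- by exists [::]; rewrite ?big_nil.
- exists (s ++ t); last by rewrite big_cat.
  by move=> p; rewrite mem_cat => /orP[/sG|/tG].
exists [seq (h * p.1, p.2) | p <- s].
  by move=> _ /mapP[p /sG Gp ->].
by rewrite big_map mulr_sumr; apply: eq_bigr => p _; rewrite mulrA.
Qed.

Lemma ideal_span_gen (G : S -> Prop) f : G f -> ideal_span G f.
Proof.
move=> Gf; exists [:: (1, f)]; last by rewrite big_seq1 mul1r.
by move=> p; rewrite inE => /eqP->.
Qed.

Lemma ideal_span_ind (G J : S -> Prop) : submodule J -> (forall f, G f -> J f) ->
  forall f, ideal_span G f -> J f.
Proof.
move=> subJ GJ _ [s sG ->]; rewrite big_seq; apply: submod_sum => // p /sG/GJ.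
exact: submodM.
Qed.

Section Membership.
Variables (I : {pred S}) (monI : monomial_ideal I).

Lemma monI_submod : submodule (fun f => f \in I).
Proof.
have [A IA] := monI; have [J0 JD JM] := ideal_span_submod
  (fun g => exists2 a, A a & g = 'X_[a]).
split=> [|f g /IA If /IA Ig|h f /IA If]; apply/IA; first exact: J0.
  exact: JD.
exact: JM.
Qed.

Lemma monI_up : upset (fun a => 'X_[a] \in I).
Proof.
by move=> a b /submK <-; rewrite mpolyXD => Ia; apply: (submodM monI_submod).
Qed.

Lemma monIP f : f \in I <-> forall a, a \in msupp f -> 'X_[a] \in I.
Proof.
split=> [|If]; last first.
  rewrite [f]mpolyE big_seq; apply: (submod_sum _ monI_submod) => a /If.
  by rewrite -mul_mpolyC; apply: (submodM monI_submod).
have [A IA] := monI => /IA[s sA ->] a.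
move=> /msupp_sum_le/flatten_mapP[p]; rewrite filter_predT => ps.
have [b Ab ->] := sA p ps; rewrite (perm_mem (msuppMX _ _)).
case/mapP => c _ ->; rewrite mpolyXD mulrC; apply: (submodM monI_submod).
by apply/IA; apply: ideal_span_gen; exists b.
Qed.

End Membership.
End MonomialIdeal.

(** * The Koszul complex *)

Section Koszul.
Local Open Scope ring_scope.
Variables (R : comNzRingType) (n : nat) (x : 'I_n -> R).
Local Notation chain := {ffun {set 'I_n} -> R}.
Implicit Types (z : chain) (F : {set 'I_n}) (k l : 'I_n) (A B : {set 'I_n}).

(** A chain [z] stands for the sum of the [z F] times the wedge product of the
    basis vectors [e_k], [k] in [F], in increasing order; [ksign] is the sign
    that moves [e_k] to the front. *)
Definition ksign k F : R := (-1) ^+ #|[set j in F | (j < k)%N]|.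

Definition contract k z : chain :=
  [ffun F : {set _} => if k \in F then 0 else ksign k F * z (k |: F)].

Definition wedge k z : chain :=
  [ffun F : {set _} => if k \in F then ksign k F * z (F :\ k) else 0].

(** The differential for the variables in [A] only; the full Koszul differential
    is the case [A = setT], and sums over disjoint [A]. *)
Definition koszul A z : chain := [ffun F : {set _} => \sum_(k in A) x k * contract k z F].

(** Wedge product with the vector [\sum_k g k e_k]. *)
Definition koszul_htpy (g : 'I_n -> R) z : chain :=
  [ffun F : {set _} => \sum_k g k * wedge k z F].

Lemma ksignK k F : ksign k F * ksign k F = 1.
Proof. by rewrite -expr2 sqrr_sign. Qed.

Lemma ksignU k l F : l \notin F ->
  ksign k (l |: F) = (-1) ^+ (l < k)%N * ksign k F.
Proof.
move=> lF; rewrite /ksign -exprD; congr (_ ^+ _).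
have -> : [set j in l |: F | (j < k)%N] =
          (if (l < k)%N then [set l] else set0) :|: [set j in F | (j < k)%N].
  apply/setP => j; rewrite !inE; case: (ltnP l k) => lk; rewrite !inE;
    by case: eqP => // ->; rewrite (negPf lF) ?lk // ltnNge lk.
case: ltnP => _; last by rewrite set0U.
by rewrite cardsU1 !inE (negPf lF).
Qed.

Lemma ksignU1 k F : ksign k (k |: F) = ksign k F.
Proof.
have [kF|kF] := boolP (k \in F); last by rewrite ksignU // ltnn mul1r.
by congr ksign; apply/setUidPr; rewrite sub1set.
Qed.

Lemma ksignD1 k F : ksign k (F :\ k) = ksign k F.
Proof.
have [kF|kF] := boolP (k \in F); first by rewrite -{2}(setD1K kF) ksignU1.
by congr ksign; apply/setDidPl; rewrite disjoint_sym disjoints1.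
Qed.

Lemma ksign_swap k l F : k != l -> k \notin F -> l \notin F ->
  ksign k F * ksign l (k |: F) = - (ksign l F * ksign k (l |: F)).
Proof.
move=> neq_kl kF lF; rewrite !ksignU //.
case: (ltngtP k l) => [lt_kl|lt_lk|/val_inj eq_kl].
- by rewrite expr1 expr0 mul1r !mulN1r mulrN mulrC.
- by rewrite expr1 expr0 mul1r !mulN1r mulrN opprK mulrC.
- by rewrite eq_kl eqxx in neq_kl.
Qed.

(** This and [contract_wedge] are the Clifford relations, from which all
    identities between differentials and homotopies follow by bilinearity. *)
Lemma contractC k l z F :
  contract k (contract l z) F = - contract l (contract k z) F.
Proof.
rewrite !ffunE !inE; have [->|neq_kl] := eqVneq k l.
  by case: ifP; rewrite /= ?mulr0 ?oppr0.
have [kF|kF] := boolP (k \in F); have [lF|lF] := boolP (l \in F);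
  rewrite ?mulr0 ?oppr0 //.
by rewrite !mulrA setUCA ksign_swap // mulNr.
Qed.

Lemma contract_self k z F : contract k (contract k z) F = 0.
Proof. by rewrite !ffunE !inE eqxx; case: ifP; rewrite ?mulr0. Qed.

Lemma contract_wedge k l z F :
  contract k (wedge l z) F + wedge l (contract k z) F = (k == l)%:R * z F.
Proof.
rewrite !ffunE !inE; have [<-|neq_kl] := eqVneq k l.
  rewrite /= mul1r.
  have [kF|kF] := boolP (k \in F).
    by rewrite add0r mulrA setD1K // ksignD1 ksignK mul1r.
  by rewrite addr0 ksignU1 mulrA ksignK mul1r setU1K.
rewrite /= mul0r.
have [kF|kF] := boolP (k \in F); have [lF|lF] := boolP (l \in F);
  rewrite ?mulr0 ?addr0 //.
have -> : (k |: F) :\ l = k |: (F :\ l).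
  apply/setP => j; rewrite !inE; case: (j =P l) => // ->.
  by rewrite eq_sym (negPf neq_kl).
rewrite !mulrA -mulrDl.
have kF' : k \notin F :\ l by rewrite !inE (negPf kF) andbF.
have lF' : l \notin F :\ l by rewrite !inE eqxx.
suff -> : ksign k F * ksign l (k |: F) = - (ksign l F * ksign k (F :\ l)).
  by rewrite addNr mul0r.
rewrite -[in ksign k F](setD1K lF) !ksignU // -ksignD1.
case: (ltngtP k l) => [lt_kl|lt_lk|/val_inj eq_kl].
- by rewrite expr1 expr0 mul1r !mulN1r mulrN mulrC.
- by rewrite expr1 expr0 mul1r !mulN1r mulNr mulrC.
- by rewrite eq_kl eqxx in neq_kl.
Qed.

Lemma contract_koszul k B z F :
  contract k (koszul B z) F = \sum_(l in B) x l * contract k (contract l z) F.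
Proof.
rewrite !ffunE; case: ifP => kF.
  by rewrite big1 // => l _; rewrite !ffunE kF mulr0.
rewrite mulr_sumr; apply: eq_bigr => l _.
by rewrite [contract k _ F]ffunE kF mulrCA.
Qed.

Lemma wedge_koszul k B z F :
  wedge k (koszul B z) F = \sum_(l in B) x l * wedge k (contract l z) F.
Proof.
rewrite !ffunE; case: ifP => kF; last first.
  by rewrite big1 // => l _; rewrite !ffunE kF mulr0.
rewrite mulr_sumr; apply: eq_bigr => l _.
by rewrite [wedge k _ F]ffunE kF mulrCA.
Qed.

Lemma contract_htpy k g z F :
  contract k (koszul_htpy g z) F = \sum_l g l * contract k (wedge l z) F.
Proof.
rewrite !ffunE; case: ifP => kF.
  by rewrite big1 // => l _; rewrite !ffunE kF mulr0.
rewrite mulr_sumr; apply: eq_bigr => l _.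
by rewrite [contract k _ F]ffunE kF mulrCA.
Qed.

Lemma koszulC A B z : koszul A (koszul B z) = - koszul B (koszul A z).
Proof.
apply/ffunP => F; rewrite !ffunE.
under eq_bigr do rewrite contract_koszul mulr_sumr.
under [in RHS]eq_bigr do rewrite contract_koszul mulr_sumr.
rewrite exchange_big -sumrN; apply: eq_bigr => l _; rewrite -sumrN.
by apply: eq_bigr => k _; rewrite contractC !mulrN mulrCA.
Qed.

Lemma koszulU1 k A z : k \notin A ->
  koszul (k |: A) z = koszul [set k] z + koszul A z.
Proof.
by move=> kA; apply/ffunP => F; rewrite !ffunE big_setU1 // big_set1.
Qed.

Lemma koszulD A z z' : koszul A (z + z') = koszul A z + koszul A z'.
Proof.
apply/ffunP => F; rewrite !ffunE -big_split; apply: eq_bigr => k _ /=.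
by rewrite -mulrDr !ffunE; case: ifP; rewrite ?addr0 ?mulrDr.
Qed.

Lemma koszulZ A c z :
  koszul A [ffun F : {set _} => c * z F] =
  [ffun F : {set _} => c * koszul A z F].
Proof.
apply/ffunP => F; rewrite !ffunE mulr_sumr; apply: eq_bigr => k _.
by rewrite !ffunE; case: ifP; rewrite ?mulr0 // !(mulrCA _ c).
Qed.

Lemma koszul0 A : koszul A 0 = 0.
Proof.
apply/ffunP => F; rewrite !ffunE big1 // => k _.
by rewrite !ffunE mulr0 if_same mulr0.
Qed.

Lemma koszulN A z : koszul A (- z) = - koszul A z.
Proof. by apply/eqP; rewrite -addr_eq0 -koszulD addNr koszul0. Qed.


(** In characteristic two this does not follow from anticommutation, so the
    variables are split off one at a time. *)
Lemma koszul_sq A z : koszul A (koszul A z) = 0.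
Proof.
have [m] := ubnP #|A|; elim: m A => // m IHm A ltAm.
have [->|[k kA]] := set_0Vmem A.
  by apply/ffunP => F; rewrite !ffunE big_set0.
rewrite -(setD1K kA); set B := A :\ k.
have kB : k \notin B by rewrite !inE eqxx.
rewrite !koszulU1 // !koszulD [koszul B (koszul [set k] z)]koszulC.
rewrite (IHm B); last first.
  by rewrite (cardsD1 k) kA -/B in ltAm.
rewrite addr0.
rewrite [X in X + _ - _](_ : _ = 0) ?add0r ?subrr //.
by apply/ffunP => F; rewrite !ffunE big_set1 contract_koszul big_set1
  contract_self !mulr0.
Qed.

(** Cartan's formula: an element of the ideal generated by the [x k] acts as
    zero on Koszul homology. *)
Lemma koszul_htpyP g z F :
  koszul setT (koszul_htpy g z) F + koszul_htpy g (koszul setT z) F =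
  (\sum_k g k * x k) * z F.
Proof.
rewrite !ffunE; under eq_bigr do rewrite contract_htpy mulr_sumr.
under [X in _ + X]eq_bigr do rewrite wedge_koszul mulr_sumr.
rewrite [X in _ + X]exchange_big -big_split big_distrl /=.
apply: eq_big => [k|k _]; first by rewrite inE.
rewrite -big_split (bigD1 k) //= big1 => [|l neq_lk].
  by rewrite mulrCA -!mulrA -mulrDr -mulrDr contract_wedge eqxx mul1r addr0 mulrCA.
by rewrite mulrCA -mulrDr -mulrDr contract_wedge eq_sym (negPf neq_lk) mul0r !mulr0.
Qed.

End Koszul.

(** * Regular sequences and depth *)

Section RegularSequences.
Local Open Scope ring_scope.
Variables (K : fieldType) (n : nat).
Local Notation S := {mpoly K[n]}.
Local Notation chain := {ffun {set 'I_n} -> S}.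
Local Notation var := (fun k : 'I_n => 'X_k : S).
Variables (I : {pred S}) (monI : monomial_ideal I) (fs : seq S).
Local Notation N r := (seq_mul_ideal (take r fs) I).
Implicit Types (f g q : S) (z y : chain) (F : {set 'I_n}).

Lemma irrelevant_idealP f :
  irrelevant_ideal f -> exists g : 'I_n -> S, f = \sum_k g k * 'X_k.
Proof.
move: f; apply: ideal_span_ind => [|_ [i ->]]; first split.
- by exists (fun=> 0); rewrite big1 // => k _; rewrite mul0r.
- move=> _ _ [g ->] [h ->]; exists (fun k => g k + h k); rewrite -big_split.
  by apply: eq_bigr => k _; rewrite mulrDl.
- move=> h _ [g ->]; exists (fun k => h * g k); rewrite mulr_sumr.
  by apply: eq_bigr => k _; rewrite mulrA.
exists (fun k => (k == i)%:R); rewrite (bigD1 i) //= eqxx mul1r big1 ?addr0 //.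
by move=> k /negPf->; rewrite mul0r.
Qed.

Lemma seq_mul_idealS r f : N r f -> N r.+1 f.
Proof.
apply: ideal_span_ind => [|_ [g [h [gfs hI ->]]]].
  exact: ideal_span_submod.
apply: ideal_span_gen; exists g, h; split=> //.
by rewrite -(@take_takel _ r r.+1) // in gfs; apply: mem_take gfs.
Qed.

Lemma seq_mul_idealS_mul r f : (r < size fs)%N -> f \in I -> N r.+1 (fs`_r * f).
Proof.
move=> lt_r fI; apply: ideal_span_gen; exists fs`_r, f; split=> //.
by rewrite (take_nth 0 lt_r) mem_rcons mem_head.
Qed.

Lemma seq_mul_idealS_inv r f : (r < size fs)%N -> N r.+1 f ->
  exists q, q \in I /\ N r (f - fs`_r * q).
Proof.
have subN := ideal_span_submod
  (fun h => exists f g, [/\ f \in take r fs, g \in I & h = f * g]).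
have subI := monI_submod monI.
move=> lt_r; move: f; apply: ideal_span_ind; first split.
- exists 0; split; first exact: (submod0 subI).
  by rewrite mulr0 subrr; apply: (submod0 subN).
- move=> g h [p [pI Np]] [q [qI Nq]]; exists (p + q).
  split; first exact: (submodD subI).
  by rewrite mulrDr opprD addrACA; apply: (submodD subN).
- move=> h g [q [qI Nq]]; exists (h * q); split; first exact: (submodM subI).
  by rewrite mulrCA -mulrBr; apply: (submodM subN).
move=> _ [g [h [gfs hI ->]]].
move: gfs; rewrite (take_nth 0 lt_r) mem_rcons inE => /orP[/eqP->|gfs].
  by exists h; split=> //; rewrite subrr; apply: (submod0 subN).
exists 0; split; first exact: (submod0 subI).
by rewrite mulr0 subr0; apply: ideal_span_gen; exists g, h.
Qed.

Lemma koszul_closed (J : S -> Prop) A z : submodule J ->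
  (forall F, J (z F)) -> forall F, J (koszul var A z F).
Proof.
move=> subJ Jz F; rewrite ffunE; apply: submod_sum => // k _.
apply: submodM => //; rewrite ffunE; case: ifP => _; first exact: submod0.
exact: submodM.
Qed.

Lemma koszul_htpy_closed (J : S -> Prop) (g : 'I_n -> S) z : submodule J ->
  (forall F, J (z F)) -> forall F, J (koszul_htpy g z F).
Proof.
move=> subJ Jz F; rewrite ffunE; apply: submod_sum => // k _.
apply: submodM => //; rewrite ffunE; case: ifP => _; last exact: submod0.
exact: submodM.
Qed.

(** Koszul homology of [I / (f_1, ..., f_r) I], phrased with relative cycles so
    that no quotient module has to be formed.  The induction adds elements of
    the sequence to the quotient.  Given a relative cycle [z] modulo [N r] and
    the next element [f], the chain [h z] given by the homotopy for [f] is a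
    relative cycle modulo [N r.+1] of one degree more, hence
    [h z = d y + f y' + nu] with [nu] in [N r]; applying the differential [d]
    gives [f (z - d y')] in [N r], and [f] can be cancelled by regularity. *)
Lemma koszul_acyclic r z : regular_sequence I fs -> (r <= size fs)%N ->
    (forall F, z F \in I) -> (forall F, N r (koszul var setT z F)) ->
    (forall F, z F != 0 -> (n < #|F| + (size fs - r))%N) ->
  exists y, (forall F, y F \in I) /\ forall F, N r ((z - koszul var setT y) F).
Proof.
move=> [fs_irr fs_reg _].
have subI := monI_submod monI; have subN r' : submodule (N r') := ideal_span_submod _.
have [d] := ubnP (size fs - r); elim: d r z => // d IHd r z.
move=> lt_d; rewrite leq_eqVlt => /orP[/eqP->|lt_r] zI Nz zbig.
  exists 0; split=> F; first by rewrite ffunE; apply: (submod0 subI).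
  rewrite koszul0 subr0; have [->|/zbig] := eqVneq (z F) 0.
    exact: (submod0 (subN _)).
  by rewrite subnn addn0 ltnNge -[X in (_ <= X)%N]card_ord max_card.
have fN := fs_reg r lt_r; set f := fs`_r in fN.
have [g def_f] := irrelevant_idealP (fs_irr f (mem_nth 0 lt_r)).
pose h := koszul_htpy g z.
have hI F : h F \in I by apply: (koszul_htpy_closed g subI).
have N_htpy F : N r (koszul_htpy g (koszul var setT z) F).
  exact: koszul_htpy_closed.
have dh F : koszul var setT h F = f * z F - koszul_htpy g (koszul var setT z) F.
  by rewrite def_f -koszul_htpyP addrK.
(* The homotopy [h] is a relative cycle for the longer sequence. *)
have [|||||y [yI Ny]] := IHd r.+1 h.
- by lia.
- exact: lt_r.
- exact: hI.
- move=> F; rewrite dh; apply: submodB => //; first exact: seq_mul_idealS_mul.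
  exact: seq_mul_idealS.
- move=> F; rewrite ffunE => hF; have [k] : exists k, wedge k z F != 0.
    apply/existsP; apply: contraR hF => /existsPn wF.
    by rewrite big1 // => k _; rewrite (eqP (negPn (wF k))) mulr0.
  rewrite ffunE; case: ifP => [kF|]; last by rewrite eqxx.
  move=> zF; have /zbig : z (F :\ k) != 0.
    by apply: contraNneq zF => ->; rewrite mulr0.
  rewrite (cardsD1 k F) kF; set c := #|_|.
  by move: c lt_r => c; clear; lia.
have /fin_all_exists[q Hq] F :
    exists q, q \in I /\ N r ((h - koszul var setT y) F - f * q).
  exact: seq_mul_idealS_inv (Ny F).
pose y' : chain := finfun q; exists y'; split=> F.
  by rewrite ffunE; case: (Hq F).
apply: fN.
  rewrite 2!ffunE; apply: (submodB subI) => //.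
  by apply: (koszul_closed setT subI) => G; rewrite ffunE; case: (Hq G).
pose nu : chain := h - koszul var setT y - [ffun F : {set _} => f * y' F].
have Nnu G : N r (koszul var setT nu G).
  by apply: koszul_closed => // {}G; have [_] := Hq G; rewrite /nu !ffunE.
suff -> : f * (z - koszul var setT y') F =
    koszul var setT nu F + koszul_htpy g (koszul var setT z) F.
  exact: (submodD (subN _)).
rewrite /nu !koszulD !koszulN koszul_sq koszulZ oppr0 addr0.
rewrite [in RHS]ffunE dh !ffunE mulrBr.
by rewrite addrAC subrK.
Qed.

Lemma depth_le d : ~ (forall f, f \in I -> f = 0) ->
    (forall gs, regular_sequence I gs -> (size gs <= d)%N) ->
  enat_le (depth I) (Some d).
Proof.
move=> nzI le_d; rewrite /depth.
case: (excluded_middle_informative _) => [/nzI//|nz /=].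
have [_ lub] := enat_supP
  (fun e => exists2 gs, regular_sequence I gs & e = Some (size gs)).
by apply: lub => _ [gs /le_d le_gs ->].
Qed.

End RegularSequences.

(** * Stanley decompositions from a partition of the exponents *)

Lemma enat_le_trans y x z : enat_le x y -> enat_le y z -> enat_le x z.
Proof. by case: x y z => [x|] [y|] [z|] //=; apply: leq_trans. Qed.

Section StanleyDecompositions.
Local Open Scope ring_scope.
Variables (K : fieldType) (n : nat).
Local Notation S := {mpoly K[n]}.
Variables (I : {pred S}) (monI : monomial_ideal I).
Implicit Types (a : 'X_{1..n}) (f : S).

(** The orthants [e i + N^(Z i)] are disjoint because [cell] recovers [i] from
    any point of the [i]-th one, and they cover the exponents of [I] because
    each exponent lies in the orthant of its own cell. *)
Lemma stanley_decomposition_cells (s : nat) (e : 'I_s -> 'X_{1..n})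
    (Z : 'I_s -> {set 'I_n}) (cell : 'X_{1..n} -> 'I_s) :
    (forall i, 'X_[e i] \in I) ->
    (forall a, 'X_[a] \in I -> (e (cell a) <= a)%MM /\
       forall k, k \notin Z (cell a) -> a k = e (cell a) k) ->
    (forall i a, (forall k, k \notin Z i -> a k = 0%N) -> cell (e i + a)%MM = i) ->
  stanley_decomposition I (fun i => 'X_[e i]) Z.
Proof.
move=> eI cellI cellK; have subI := monI_submod monI.
have nzX a : 'X_[a] != 0 :> S.
  by rewrite -msupp_eq0 msuppX.
split=> [i|f|w Hw sum_w i].
- split=> //; first by exists 1, (e i); rewrite scale1r.
  by move=> v _ /eqP; rewrite mulf_eq0 (negPf (nzX _)) => /eqP.
- split=> [fI|[w Hw ->]]; last first.
    apply: (submod_sum _ subI) => i _; have [v _ ->] := Hw i.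
    by rewrite mulrC; apply: (submodM subI).
  exists (fun i => \sum_(a <- msupp f | cell a == i) f@_a *: 'X_[a]); last first.
    rewrite {1}[f]mpolyE (partition_big cell xpredT) //=.
  move=> i; exists (\sum_(a <- msupp f | cell a == i) f@_a *: 'X_[a - e i]).
    move=> b /msupp_sum_le/flatten_mapP[a].
    rewrite mem_filter => /andP[/eqP <- af] /msuppZ_le.
    rewrite msuppX inE => /eqP-> k kZ; rewrite mnmBE.
    have /cellI[_ ->//] : 'X_[a] \in I by apply: (monIP monI f).1.
    by rewrite subnn.
  rewrite mulr_sumr big_seq_cond [RHS]big_seq_cond.
  apply: eq_bigr => a /andP[af /eqP <-].
  rewrite -scalerAr -mpolyXD addmC submK //.
  by have /cellI[] : 'X_[a] \in I by apply: (monIP monI f).1.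
apply/mpolyP => a; rewrite mcoeff0.
have w_cell j : cell a != j -> (w j)@_a = 0.
  have [v vZ ->] := Hw j => neq_aj; apply/eqP; rewrite mcoeff_eq0 mulrC.
  rewrite (perm_mem (msuppMX _ _)); apply: contra neq_aj => /mapP[b /vZ bZ ->].
  by apply/eqP/cellK => k; apply: bZ.
have [<-|] := eqVneq (cell a) i; last exact: w_cell.
have := congr1 (mcoeff a) sum_w; rewrite mcoeff0 raddf_sum (bigD1 (cell a)) //=.
by rewrite big1 ?addr0 // => j; rewrite eq_sym; apply: w_cell.
Qed.

Lemma enat_le_sdepth_decomposition d s (Z : 'I_s -> {set 'I_n}) :
  (forall i, (d <= #|Z i|)%N) -> enat_le (Some d) (sdepth_decomposition Z).
Proof.
move=> le_d; apply: (big_ind (enat_le (Some d))) => //= x y.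
by rewrite /enat_min; case: ifP.
Qed.

Lemma sdepth_ge d s (u : 'I_s -> S) (Z : 'I_s -> {set 'I_n}) :
    stanley_decomposition I u Z -> (forall i, (d <= #|Z i|)%N) ->
  enat_le (Some d) (sdepth I).
Proof.
move=> decI /enat_le_sdepth_decomposition le_d.
have [ub _] := enat_supP (fun d => exists s (u : 'I_s -> S) Z,
  stanley_decomposition I u Z /\ d = sdepth_decomposition Z).
by apply: enat_le_trans le_d _; apply: ub; exists s, u, Z.
Qed.

(** The empty decomposition has depth [None]. *)
Lemma sdepth_zero : (forall f, f \in I -> f = 0) -> sdepth I = None.
Proof.
move=> I0; have [ub _] := enat_supP (fun d => exists s (u : 'I_s -> S) Z,
  stanley_decomposition I u Z /\ d = sdepth_decomposition Z).
suff : enat_le None (sdepth I) by rewrite /sdepth; case: enat_sup.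
apply: ub; exists 0, (fun _ => 0), (fun _ => set0).
split; last by rewrite /sdepth_decomposition big_ord0.
split=> [[]//|f|w _ _ []//]; split=> [/I0 ->|[w _ ->]].
  by exists (fun _ => 0); rewrite ?big_ord0 // => -[].
by rewrite big_ord0; apply: (submod0 (monI_submod monI)).
Qed.

End StanleyDecompositions.

(** * Corners of a monomial ideal and its associated primes *)

Section Corners.
Local Open Scope ring_scope.
Variables (K : fieldType) (n : nat).
Local Notation S := {mpoly K[n]}.
Variables (I : {pred S}) (monI : monomial_ideal I) (N : nat).
Hypothesis truncI : forall a, 'X_[mnm_trunc N a] \in I <-> 'X_[a] \in I.
Implicit Types (a b c : 'X_{1..n}) (j k t : 'I_n).

(** Maximal exponents of the box [[0, N]^n] outside the ideal.  A coordinate equal to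
    [N] is to be thought of as infinite: corners are the irreducible components
    of the ideal. *)
Definition corner b : bool :=
  [&& [forall k, (b k <= N)%N], 'X_[b] \notin I &
      [forall k, (b k < N)%N ==> ('X_[b + U_(k)] \in I)]].

Lemma corner_below b a :
  corner b -> (forall k, (b k < N)%N -> (a k <= b k)%N) -> 'X_[a] \notin I.
Proof.
move=> /and3P[/forallP leN + _] le_ab; apply: contra => /truncI.
apply: (monI_up monI); apply/mnm_lepP => k; rewrite mnmE.
have := leN k; rewrite leq_eqVlt => /orP[/eqP->|/le_ab]; first exact: geq_minr.
by apply: leq_trans; apply: geq_minl.
Qed.

(** With [corner_below]: the ideal is the intersection of the irreducible
    ideals given by its corners. *)
Lemma corner_above a : 'X_[a] \notin I ->
  exists2 b, corner b & forall k, (b k < N)%N -> (a k <= b k)%N.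
Proof.
(* Climb inside the box; [d] bounds the number of steps left. *)
have up_box c d : (n * N < mdeg c + d)%N -> (forall k, (c k <= N)%N) ->
    'X_[c] \notin I -> exists2 b, corner b & (c <= b)%MM.
  elim: d c => [|d IHd] c ltd leN cI.
    move: ltd; rewrite addn0 ltnNge mdegE => /negP[].
    by rewrite -[X in (X * N)%N]card_ord -sum_nat_const leq_sum.
  have [/forallP top|] := boolP [forall k, (c k < N)%N ==> ('X_[c + U_(k)] \in I)].
    by exists c; rewrite ?lepm_refl // /corner cI /=; apply/andP; split; apply/forallP.
  move=> /forallPn[k]; rewrite negb_imply => /andP[ltk ckI].
  have [||b cb le_b] := IHd (c + U_(k))%MM _ _ ckI.
  - by rewrite mdegD mdeg1 addn1 addSnnS.
  - move=> j; rewrite mnmDE mnm1E; case: (k =P j) => [<-|_]; first by rewrite addn1.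
    by rewrite addn0.
  by exists b => //; apply: lepm_trans le_b; apply: lem_addr; apply: lepm_refl.
move=> aI; have [|||b cb /mnm_lepP le_b] := up_box (mnm_trunc N a) (n * N).+1.
- by rewrite addnS ltnS leq_addl.
- by move=> k; rewrite mnmE geq_minr.
- by apply: contra aI => /truncI.
exists b => // k ltk; have := le_b k; rewrite mnmE geq_min => /orP[//|].
by rewrite leqNgt ltk.
Qed.

Lemma corner_up b k : corner b -> (b k < N)%N -> 'X_[b + U_(k)] \in I.
Proof. by case/and3P=> _ _ /forallP/(_ k)/implyP. Qed.

Local Notation box := {ffun 'I_n -> 'I_N.+1}.

Definition box_mnm (c : box) : 'X_{1..n} := [multinom (c k : nat) | k < n].

Lemma corner_box b : corner b -> exists c : box, box_mnm c = b.
Proof.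
case/and3P=> /forallP leN _ _; exists [ffun k => inord (b k)].
by apply/mnmP => k; rewrite mnmE ffunE inordK // ltnS.
Qed.

Lemma mem_colon_corner b g : corner b ->
  g * 'X_[b] \in I <-> forall a, a \in msupp g -> exists k, (b k < N)%N && (0 < a k)%N.
Proof.
move=> cb; have monP := monIP monI (g * 'X_[b]).
split=> [/monP gbI a ag|meets].
  apply/existsP; apply: contraTT (gbI (b + a)%MM _) => [/existsPn off|].
    apply: (corner_below cb) => k lt_bk; have := off k.
    by rewrite lt_bk -leqNgt leqn0 mnmDE => /eqP->; rewrite addn0.
  by rewrite (perm_mem (msuppMX _ _)); apply: map_f.
apply/monP => a; rewrite (perm_mem (msuppMX _ _)) => /mapP[a' /meets[k /andP[bk ak]] ->].
apply: (monI_up monI) (corner_up cb bk); apply/mnm_lepP => j.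
rewrite !mnmDE leq_add2l mnm1E; case: eqP => // <-; exact: ak.
Qed.

(** The colon ideal is the kernel of the substitution of [0] for the variables
    [k] with [b k < N], so it is prime because polynomials form a domain. *)
Lemma corner_associated b :
  corner b -> associated_prime I [pred g | g * 'X_[b] \in I].
Proof.
move=> cb; have subI := monI_submod monI; split; last by exists 'X_[b].
pose kill := comp_mpoly [tuple if (b k < N)%N then 0 else 'X_k : S | k < n].
have killX a : kill 'X_[a] =
    if [exists k, (b k < N)%N && (0 < a k)%N] then 0 else 'X_[a].
  rewrite /kill comp_mpolyX; case: ifP => [/existsP[k /andP[bk ak]]|/existsPn off].
    by rewrite (bigD1 k) //= tnth_mktuple bk expr0n -leqn0 leqNgt ak mul0r.
  rewrite [RHS]mpolyXE_id; apply: eq_bigr => k _; rewrite tnth_mktuple.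
  by have := off k; case: ifP => //= _; rewrite -leqNgt leqn0 => /eqP->; rewrite !expr0.
have killE g : kill g = \sum_(a <- msupp g) g@_a *: kill 'X_[a].
  by rewrite {1}[g]mpolyE /kill linear_sum; apply: eq_bigr => a _; rewrite linearZ.
have memP g : g * 'X_[b] \in I <-> kill g = 0.
  rewrite (mem_colon_corner g cb) killE.
  split=> [meets|sum0 a ag].
    rewrite big_seq big1 // => a /meets/existsP off.
    by rewrite killX off scaler0.
  apply/existsP; move: (ag); apply: contraTT => off; rewrite -mcoeff_eq0.
  have := congr1 (mcoeff a) sum0; rewrite mcoeff0 raddf_sum (bigD1_seq a) //=.
  rewrite killX (negPf off) mcoeffZ mcoeffX eqxx mulr1.
  rewrite big1 ?addr0 => [->//|a' neq_a]; rewrite killX.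
  by case: ifP => _; rewrite mcoeffZ ?mcoeff0 ?mcoeffX ?(negPf neq_a) mulr0.
split=> [|g h]; last first.
  rewrite !inE => /memP; rewrite /kill rmorphM => /eqP; rewrite mulf_eq0.
  by move=> /orP[/eqP/memP->|/eqP/memP->]; rewrite ?orbT.
split=> [||h g g']; rewrite !inE ?mul0r ?mul1r.
- exact: (submod0 subI).
- by case/and3P: cb.
- by move=> gI g'I; rewrite mulrDl -mulrA; apply: (submodD subI) => //;
     apply: (submodM subI).
Qed.

Lemma corner_associated_var b k :
  corner b -> ('X_k \in [pred g | g * 'X_[b] \in I]) = (b k < N)%N.
Proof.
move=> cb; rewrite inE; apply/idP/idP => [/(mem_colon_corner _ cb)|bk].
  case/(_ U_(k)%MM) => [|j]; first by rewrite msuppX mem_head.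
  by rewrite mnm1E => /andP[bj]; case: eqP => // ->.
by rewrite -mpolyXD addmC; apply: corner_up.
Qed.

(** From here on, [V] is the union of the variable sets of the corners, which
    are pairwise disjoint, and [pi] maps each element of such a set to the
    element chosen in it; outside [V] it is the identity.  The fixpoints of [pi]
    are the transversal [T]. *)
Section Blocks.
Variables (pi : 'I_n -> 'I_n) (V : {set 'I_n}).
Hypothesis piK : forall k, pi (pi k) = pi k.
Hypothesis free_block : forall j k, k \notin V -> (pi j == k) = (j == k).
Hypothesis block_corner : forall k, k \in V ->
  exists2 b, corner b & forall j, (b j < N)%N = (pi j == pi k).
Hypothesis corner_block : forall b, corner b ->
  exists t, [/\ t \in V, pi t = t & forall k, (b k < N)%N = (pi k == t)].

Local Notation T := [set k | pi k == k].
Local Notation chain := {ffun {set 'I_n} -> S}.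
Local Notation var := (fun k : 'I_n => 'X_k : S).
Local Notation kos t z := (koszul var [set k | pi k == t] z).

(** * The depth is at most the size of the transversal *)

Lemma pi_free k : k \notin V -> pi k = k.
Proof. by move=> kV; apply/eqP; rewrite free_block. Qed.

Lemma pi_V k : (pi k \in V) = (k \in V).
Proof.
have [kV|kV] := boolP (k \in V); last by rewrite pi_free // (negPf kV).
by apply: contraLR kV => kV; have := free_block k kV; rewrite eqxx => /esym/eqP ->.
Qed.

(** The chain [d_{t_1} ... d_{t_r} e_V], where [d_t] is the Koszul differential
    for the block of [t].  Up to sign, when [s] meets every block once it is the
    wedge product of the boundaries of the [e_Z], [Z] a block. *)
Definition block_chain (s : seq 'I_n) : chain :=
  foldr (fun t z => kos t z) [ffun F : {set 'I_n} => (F == V)%:R] s.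

Lemma koszulT z F : koszul var setT z F = \sum_(t in T) kos t z F.
Proof.
rewrite !ffunE (partition_big pi (mem T)) => [|k _]; last by rewrite [_ (pi k)]inE piK.
by apply: eq_bigr => t _; rewrite ffunE; apply: eq_bigl => k; rewrite !inE.
Qed.

Lemma block_chain_cycle s t : t \in s -> kos t (block_chain s) = 0.
Proof.
elim: s => //= t' s IHs; rewrite inE; have [->|_ /IHs tw] := eqVneq t t'.
  by rewrite koszul_sq.
by rewrite koszulC tw koszul0 oppr0.
Qed.

Lemma block_chain_free s t : t \notin V -> kos t (block_chain s) = 0.
Proof.
move=> tV; elim: s => [|t' s IHs] /=; last by rewrite koszulC IHs koszul0 oppr0.
apply/ffunP => F; rewrite !ffunE big1 // => k.
rewrite inE free_block // => /eqP->; rewrite !ffunE; case: ifP => _.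
  by rewrite mulr0.
case: eqP => [eV|_]; last by rewrite !mulr0.
by rewrite -eV setU11 in tV.
Qed.

Lemma block_chain_card s F : block_chain s F != 0 -> (#|V| <= #|F| + size s)%N.
Proof.
elim: s F => [|t s IHs] F /=.
  by rewrite ffunE; case: (F =P V) => [->|_]; rewrite ?eqxx // addn0.
rewrite ffunE => nz; have [k] : exists k, contract k (block_chain s) F != 0.
  apply/existsP; apply: contraR nz => /existsPn wF.
  by rewrite big1 // => k _; rewrite (eqP (negPn (wF k))) mulr0.
rewrite ffunE; case: ifP => [|kF]; first by rewrite eqxx.
move=> wF; have /IHs : block_chain s (k |: F) != 0.
  by apply: contraNneq wF => ->; rewrite mulr0.
by rewrite cardsU1 kF addnS add1n.
Qed.

(** Each differential [d_t] multiplies by a variable of the block of [t]; this is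
    what brings the coefficients into the ideal. *)
Lemma block_chain_msupp s F a t : a \in msupp (block_chain s F) -> t \in s ->
  exists2 k, pi k = t & (0 < a k)%N.
Proof.
elim: s F a => //= t' s IHs F a; rewrite ffunE => /msupp_sum_le/flatten_mapP[k].
rewrite mem_filter inE => /andP[/eqP pik _]; rewrite ffunE.
case: ifP => [_|_]; first by rewrite mulr0 msupp0.
rewrite mulrCA /ksign; set e := #|_|.
have -> g : (-1) ^+ e * g = (-1) ^+ odd e * g :> S by rewrite signr_odd.
have -> g : msupp ((-1) ^+ odd e * g : S) =i msupp g.
  by case: (odd e) => a' /=; rewrite ?mul1r // mulN1r (perm_mem (msuppN _)).
rewrite mulrC (perm_mem (msuppMX _ _)) => /mapP[a' a'w ->].
rewrite inE => /orP[/eqP->|ts]; first by exists k; rewrite ?mnmDE ?mnm1E ?eqxx.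
by have [k' pik' lt_a'] := IHs _ _ a'w ts; exists k' => //; rewrite mnmDE ltn_addl.
Qed.

(** At [V] minus the transversal a single term survives: the block of [t]
    has no other element outside the argument than [t] itself. *)
Lemma block_chain_transversal s :
    uniq s -> {subset s <= V} -> {in s, forall t, pi t = t} ->
  exists e, block_chain s (V :\: [set t in s]) =
            (-1) ^+ e * 'X_[\sum_(t <- s) U_(t)].
Proof.
elim: s => [|t s IHs] /=.
  exists 0; rewrite ffunE big_nil mpolyX0 mulr1 expr0.
  suff -> : V :\: [set t in [::]] = V by rewrite eqxx.
  by apply/setP => k; rewrite !inE.
move=> /andP[ts us] sV sT; have [||e IHe] := IHs us.
- by move=> j js; apply: sV; rewrite inE js orbT.
- by move=> j js; apply: sT; rewrite inE js orbT.
have tV : t \in V by rewrite sV ?mem_head.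
set F := V :\: _; have tF : t \notin F by rewrite !inE eqxx.
exists (#|[set j in F | (j < t)%N]| + e).
rewrite ffunE (bigD1 t) /=; last by rewrite inE sT ?mem_head.
rewrite big1 ?addr0 => [|k /andP[]].
  rewrite ffunE (negPf tF) (_ : t |: F = V :\: [set j in s]).
    rewrite IHe big_cons mpolyXD exprD [RHS]mulrACA [LHS]mulrA.
    by congr (_ * _); apply: mulrC.
  apply/setP => j; rewrite !inE; case: eqP => //= ->.
  by rewrite tV ts.
rewrite inE => /eqP pik neq_kt; rewrite ffunE ifT ?mulr0 // !inE -pi_V pik tV andbT.
rewrite (negPf neq_kt) /=; apply: contra neq_kt => ks.
by rewrite -pik sT // inE ks orbT.
Qed.

(** The cycle [w] is [block_chain] times the monomial that agrees with a corner
    on each block: multiplied by one variable of every block that monomial lies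
    in [I], so [w] has coefficients in [I].  It is no boundary of a chain with
    coefficients in [I]: in multidegree [alpha] at [F0], a boundary would need a
    coefficient whose exponent agrees with a corner on some block. *)
Lemma regular_sequence_bound fs : regular_sequence I fs -> (size fs <= #|T|)%N.
Proof.
move=> reg; rewrite leqNgt; apply/negP => lt_T.
have subI := monI_submod monI.
pose s := enum (T :&: V).
have sTV t : (t \in s) = (pi t == t) && (t \in V) by rewrite mem_enum !inE.
have /fin_all_exists[c Hc] k : exists b, k \in V ->
    corner b /\ forall j, (b j < N)%N = (pi j == pi k).
  have [/block_corner[b cb Hb]|] := boolP (k \in V); first by exists b.
  by exists 0%MM.
(* The corners of one block may differ; [c (pi k)] fixes one per block. *)
pose gamma := [multinom if k \in V then c (pi k) k else 0%N | k < n].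
have gammaE t k : t \in s -> pi k = t -> gamma k = c t k.
  by rewrite sTV => /andP[_ tV] pik; rewrite mnmE -pi_V pik tV.
have c_corner t : t \in s -> corner (c t) /\ forall k, (c t k < N)%N = (pi k == t).
  by rewrite sTV => /andP[/eqP pit /Hc[]]; rewrite pit.
pose w : chain := [ffun F : {set 'I_n} => 'X_[gamma] * block_chain s F].
(* An exponent of [w F] outside [I] would lie below a corner [b], and then
   [c t + U_(k)], for [t] the block of [b], would lie below [b] as well,
   against the maximality of [c t]. *)
have wI F : w F \in I.
  apply/(monIP monI) => a; rewrite ffunE mulrC (perm_mem (msuppMX _ _)).
  case/mapP => a0 a0w ->; apply/negPn/negP => /corner_above[b cb le_b].
  have [t [tV pit bt]] := corner_block cb.
  have ts : t \in s by rewrite sTV pit eqxx.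
  have [k pik lt_a0] := block_chain_msupp a0w ts.
  have [cct ct] := c_corner t ts.
  have /negP[] : 'X_[c t + U_(k)] \notin I.
    apply: (corner_below cb) => j lt_bj; apply: leq_trans (le_b j lt_bj).
    have /eqP pij : pi j == t by rewrite -bt.
    rewrite !mnmDE mnm1E (gammaE t) // leq_add2l.
    by case: eqP => // <-.
  by apply: (corner_up cct); rewrite ct pik.
have cyc : koszul var setT w = 0.
  rewrite koszulZ; apply/ffunP => F; rewrite ffunE koszulT big1 ?mulr0 ?ffunE //.
  move=> t; rewrite inE => pit; have [tV|tV] := boolP (t \in V).
    by rewrite block_chain_cycle ?sTV ?pit // ffunE.
  by rewrite block_chain_free // ffunE.
have [||||y [yI Hy]] := @koszul_acyclic K n I monI fs 0 w reg.
- by [].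
- exact: wI.
- by move=> F; rewrite cyc ffunE; apply: (submod0 (ideal_span_submod _)).
- move=> F; rewrite ffunE subn0 => nz.
  have /block_chain_card : block_chain s F != 0.
    by apply: contraNneq nz => ->; rewrite mulr0.
  rewrite -cardE => leV.
  have freeT : ~: V \subset T.
    by apply/subsetP => k; rewrite !inE => /pi_free/eqP.
  have TDV : T :\: V = ~: V by rewrite setDE; apply/setIidPr.
  rewrite -[X in (X < _)%N](card_ord n) -(cardsC V).
  apply: (@leq_ltn_trans (#|F| + #|T|)); last by rewrite ltn_add2l.
  by rewrite -(cardsID V T) TDV addnA leq_add2r.
have [||e wF0] := @block_chain_transversal s (enum_uniq _).
- by move=> t; rewrite sTV => /andP[].
- by move=> t; rewrite sTV => /andP[/eqP].
set F0 := V :\: _ in wF0.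
pose alpha := (gamma + \sum_(t <- s) U_(t))%MM.
have sum_s k : (\sum_(t <- s) U_(t))%MM k = (k \in s) :> nat.
  rewrite mnm_sumE; have [ks|ks] := boolP (k \in s).
    rewrite (bigD1_seq k) ?enum_uniq //= mnm1E eqxx big1 // => t /negPf.
    by rewrite mnm1E => ->.
  rewrite big_seq big1 // => t ts; rewrite mnm1E.
  by case: eqP ts ks => // -> ->.
have {Hy} : w F0 = koszul var setT y F0.
  apply/eqP; rewrite -subr_eq0; have := Hy F0; rewrite take0 !ffunE.
  by case=> -[|p r] Hp -> ; [rewrite big_nil | have [? [? []]] := Hp p (mem_head _ _)].
move=> /(congr1 (mcoeff alpha)); rewrite ffunE wF0 mulrCA -mpolyXD.
rewrite [RHS](_ : _ = 0).
  move/eqP; rewrite -signr_odd mulr_sign; case: (odd e).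
    by rewrite mcoeffN mcoeffX eqxx oppr_eq0 oner_eq0.
  by rewrite mcoeffX eqxx oner_eq0.
rewrite ffunE raddf_sum big1 //= => k _; apply/eqP; rewrite mcoeff_eq0 ffunE.
case: ifP => [_|kF0]; first by rewrite mulr0 msupp0.
apply/negP; rewrite mulrC (perm_mem (msuppMX _ _)) => /mapP[a aI alphaE].
have {}aI : 'X_[a] \in I.
  by apply: (monIP monI _).1 aI; apply: (submodM subI).
have alphak : alpha k != 0%N by rewrite alphaE mnmDE mnm1E eqxx add1n.
have kV : k \in V.
  apply: contraNT alphak => kV.
  by rewrite mnmDE mnmE (negPf kV) sum_s sTV (negPf kV) andbF.
have ks : k \in s by move: kF0; rewrite !inE kV andbT => /negbFE.
have [cck ck] := c_corner k ks.
suff /negP : 'X_[a] \notin I by [].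
apply: (corner_below cck) => j; rewrite ck => /eqP pij.
have := congr1 (fun a : 'X_{1..n} => a j) alphaE.
rewrite /alpha !mnmDE sum_s (gammaE k) // sTV mnm1E pij.
by case: (k =P j) => [->|_] /=; lia.
Qed.

(** * The Stanley depth is at least the size of the transversal *)

(** [threshold t c] is the least exponent of ['X_t] that escapes all the corners
    of the block of [t] still in force when the other exponents of that block
    are given by [c]; it is [0] when there are none. *)
Definition threshold (t : 'I_n) (c : box) : nat :=
  \max_(b : box | [&& corner (box_mnm b), (b t < N)%N &
           [forall j, (b j < N)%N && (j != t) ==> (c j <= b j)%N]]) (b t).+1.

(** The exponents outside the transversal, truncated at [N]; the value [N] on the
    transversal makes the directions of the cell of [c] exactly the [k] with
    [c k = N]. *)
Definition profile (a : 'X_{1..n}) : box :=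
  [ffun k => inord (if pi k == k then N else minn (a k) N)].

Lemma profileE a k : profile a k = (if pi k == k then N else minn (a k) N) :> nat.
Proof. by rewrite ffunE inordK // ltnS; case: ifP => // _; apply: geq_minr. Qed.

Lemma memI_threshold a :
  'X_[a] \in I <-> forall t, pi t = t -> (threshold t (profile a) <= a t)%N.
Proof.
split=> [aI t pit|le_a].
  apply/bigmax_leqP => b /and3P[cb lt_bt /forallP le_b].
  rewrite ltnNge; apply: contraL aI => le_at; apply: (corner_below cb) => j.
  rewrite mnmE => lt_bj; have [->//|neq_jt] := eqVneq j t.
  have [t' [_ _ Zb]] := corner_block cb.
  have /eqP pij : pi j == t.
    by move: (Zb j) (Zb t); rewrite !mnmE lt_bj lt_bt pit => /esym/eqP-> /esym/eqP->.
  have := le_b j; rewrite lt_bj neq_jt profileE pij eq_sym (negPf neq_jt) /=.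
  by rewrite geq_min => /orP[//|]; rewrite leqNgt lt_bj.
apply/negPn/negP => /corner_above[b cb le_b].
have [t [tV pit Zb]] := corner_block cb.
have [bb def_b] := corner_box cb.
have bbE k : bb k = b k :> nat by rewrite -def_b mnmE.
have bt : (b t < N)%N by rewrite Zb pit.
have := le_a t pit; rewrite leqNgt => /negP[].
apply: leq_ltn_trans (le_b t bt) _.
rewrite -[X in (X < _)%N]bbE; apply: (leq_bigmax_cond (F := fun b : box => (b t).+1)).
rewrite def_b cb bbE bt; apply/forallP => j; rewrite !bbE.
apply/implyP => /andP[bj neq_jt].
have := bj; rewrite Zb profileE => /eqP ->; rewrite eq_sym (negPf neq_jt).
by rewrite geq_min le_b.
Qed.

Lemma sdepth_bound : enat_le (Some #|T|) (sdepth I).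
Proof.
pose C := [set c : box | [forall k, (pi k == k) ==> (c k == N :> nat)]].
have CP (c : box) k : c \in C -> pi k = k -> c k = N :> nat.
  by rewrite inE => /forallP/(_ k); move=> /[swap] -> /=; rewrite eqxx => /eqP.
have profileC a : profile a \in C.
  rewrite inE; apply/forallP => k; apply/implyP => pik.
  by rewrite profileE pik.
pose e (c : box) := [multinom if pi k == k then threshold k c else c k | k < n].
pose cell a := enum_rank_in (profileC 0%MM) (profile a).
have cellE a : enum_val (cell a) = profile a by rewrite enum_rankK_in.
have profile_e (c : box) a : c \in C -> (forall k, c k != N :> nat -> a k = 0%N) ->
    profile (e c + a)%MM = c.
  move=> cC a0; apply/ffunP => k; apply: val_inj; rewrite /= profileE.
  case: eqP => [/CP->//|/eqP pik]; rewrite mnmDE mnmE (negPf pik).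
  have := ltn_ord (c k); have [->|/a0->] := eqVneq (c k : nat) N; last lia.
  lia.
apply: (@sdepth_ge _ _ _ _ #|C| (fun i => 'X_[e (enum_val i)])
          (fun i => [set k | enum_val i k == N :> nat])); last first.
  move=> i; apply: subset_leq_card; apply/subsetP => k; rewrite !inE => /eqP.
  by move/(CP _ _ (enum_valP i)) => ->.
apply: (stanley_decomposition_cells monI (cell := cell)) => [i|a|i a a0].
- apply/memI_threshold => t pit; rewrite -[e _]addm0 profile_e ?enum_valP //.
    by rewrite addm0 mnmE pit eqxx.
  by move=> k _; rewrite mnm0E.
- move=> aI; rewrite cellE; split.
    apply/mnm_lepP => k; rewrite mnmE; case: eqP => [|/eqP pik].
      exact: (memI_threshold a).1.
    by rewrite profileE (negPf pik) geq_minl.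
  move=> k; rewrite inE mnmE profileE; case: (pi k =P k) => _; first by rewrite eqxx.
  by rewrite eqn_leq geq_minr leq_min leqnn andbT -ltnNge => /ltnW/minn_idPl->.
apply: enum_val_inj; rewrite cellE profile_e ?enum_valP // => k kN.
by apply: a0; rewrite inE.
Qed.

End Blocks.
End Corners.

(** * Transversals of disjoint sets, and prime ideals *)

(** A transversal of disjoint nonempty sets, presented as the fixpoints of the
    map to representatives; an element in none of the sets is fixed, and is the
    image of itself alone. *)
Lemma block_retraction (T : finType) (Zs : {set {set T}}) :
    trivIset Zs -> set0 \notin Zs ->
  exists pi : T -> T, [/\ forall k, pi (pi k) = pi k,
    forall j k, k \notin cover Zs -> (pi j == k) = (j == k) &
    forall Z, Z \in Zs -> exists t, [/\ t \in Z, pi t = t &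
      forall k, (k \in Z) = (pi k == t)]].
Proof.
move=> tiZ nz0; pose pi k := odflt k [pick j in pblock Zs k].
have pi_out k : k \notin cover Zs -> pi k = k.
  move=> kZ; suff pk0 : pblock Zs k = set0.
    by rewrite /pi pk0; case: pickP => //= j; rewrite inE.
  rewrite /pblock; case: pickP => //= B /andP[BZ kB].
  by case/negP: kZ; apply/bigcupP; exists B.
have pick_in (Z : {set T}) k j : k \in Z -> odflt j [pick i in Z] \in Z /\
    odflt j [pick i in Z] = odflt k [pick i in Z].
  by case: pickP => //= none kZ; have := none k; rewrite /= kZ.
have piE k Z : Z \in Zs -> k \in Z -> pi k = odflt k [pick j in Z].
  by move=> ZZ kZ; rewrite /pi (def_pblock tiZ ZZ kZ).
have pi_in k Z : Z \in Zs -> k \in Z -> pi k \in Z /\ pi (pi k) = pi k.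
  move=> ZZ kZ; have [pkZ _] := pick_in Z k k kZ; rewrite -(piE k Z) // in pkZ.
  by split=> //; rewrite (piE _ Z) // (pick_in Z k _ kZ).2 -piE.
exists pi; split=> [k|j k kZ|Z ZZ].
- have [/bigcupP[Z ZZ kZ]|kZ] := boolP (k \in cover Zs); first by case: (pi_in k Z).
  by rewrite !pi_out.
- have [/bigcupP[Z ZZ jZ]|jZ] := boolP (j \in cover Zs); last by rewrite pi_out.
  have ncov B : B \in Zs -> k \notin B.
    by move=> BZ; apply: contra kZ => kB; apply/bigcupP; exists B.
  have [pjZ _] := pi_in j Z ZZ jZ.
  by transitivity false; [|symmetry]; apply: contraTF (ncov Z ZZ) => /eqP<-; apply/negPn.
have [Z0|[k0 kZ0]] := set_0Vmem Z; first by rewrite -Z0 ZZ in nz0.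
have [tZ pit] := pi_in k0 Z ZZ kZ0; exists (pi k0); split=> // k.
apply/idP/eqP => [kZ|pik].
  by rewrite (piE k Z) // (piE k0 Z) // (pick_in Z k0 _ kZ0).2.
have [/bigcupP[B BZ kB]|kB] := boolP (k \in cover Zs); last by rewrite -(pi_out k kB) pik.
have [pkB _] := pi_in k B BZ kB; rewrite pik in pkB.
by rewrite -(def_pblock tiZ ZZ tZ) (def_pblock tiZ BZ pkB).
Qed.

Section PrimeIdeals.
Local Open Scope ring_scope.
Variables (K : fieldType) (n : nat) (P : {pred {mpoly K[n]}}).
Hypothesis primeP : prime_ideal P.

Lemma prime_ideal_var_gen k : 'X_k \in P -> min_mon_gens P U_(k)%MM.
Proof.
have [[_ P1 _] _] := primeP => kP; split=> // b bP /mnm_lepP le_b.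
have [bk|bk] := posnP (b k).
  case/negP: P1; rewrite -(mpolyX0 n K) (_ : 0%MM = b) //.
  apply/mnmP => j; rewrite mnm0E; have := le_b j; rewrite mnm1E.
  by case: eqP => [<-|_]; rewrite ?bk // leqn0 => /eqP.
apply/mnmP => j; apply/eqP; rewrite eqn_leq le_b mnm1E.
by case: eqP => // <-.
Qed.

Lemma prime_ideal_mpolyX a : 'X_[a] \in P -> exists2 k, (0 < a k)%N & 'X_k \in P.
Proof.
have [[_ P1 _] Pp] := primeP => aP.
have [/existsP[k /andP[]]|/existsPn none] :=
  boolP [exists k, (0 < a k)%N && ('X_k \in P)].
  by exists k.
suff /negP : 'X_[a] \notin P by [].
have mulP g h : g \notin P -> h \notin P -> g * h \notin P.
  by move=> gP hP; apply/negP => /Pp; rewrite (negPf gP) (negPf hP).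
rewrite mpolyXE_id; apply: (big_ind (fun g => g \notin P)) => // k _.
have := none k; case: (posnP (a k)) => [->|_] /= kP; first by rewrite expr0.
elim: (a k) => [|e IHe]; first by rewrite expr0.
by rewrite exprS; apply: mulP.
Qed.

End PrimeIdeals.

(** * Comparison of depth, Stanley depth and associated primes *)

Theorem corollary1p12 (K : fieldType) (n : nat) (I : {pred {mpoly K[n]}})
    (m : nat) (P : 'I_m -> {pred {mpoly K[n]}})
    (monI : monomial_ideal I)
    (assI : forall Q : {pred {mpoly K[n]}},
        associated_prime I Q <-> exists i : 'I_m, Q =i P i)
    (distinctP : forall i j : 'I_m, i != j -> ~ (P i =i P j))
    (disjointP : forall i j : 'I_m, i != j ->
        forall a : 'X_{1..n}, ~ (min_mon_gens (P i) a /\ min_mon_gens (P j) a)) :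
  enat_le (Some m) (sdepth I) /\ enat_le (depth I) (sdepth I).
Proof.
have [I0|nzI] := excluded_middle_informative (forall f, f \in I -> f = 0%R).
  by rewrite (sdepth_zero monI I0); split=> //; case: (depth I).
have subI := monI_submod monI.
have [a0 a0I] : exists a, 'X_[a] \in I.
  apply: NNPP => none; case: nzI => f /(monIP monI f) fI.
  apply/eqP; rewrite -msupp_eq0; case: (msupp f) fI => // a s fI.
  by case: none; exists a; apply: fI; rewrite mem_head.
have [N truncI] := upset_trunc (monI_up monI).
have assP i : associated_prime I (P i) by apply/assI; exists i.
have primeP i := (assP i).1.
have corner_ass b : corner I N b ->
    exists i, forall k, ('X_k \in P i) = (b k < N).
  move=> cb; have [i Pi] := (assI _).1 (corner_associated monI truncI cb).
  by exists i => k; rewrite -Pi (corner_associated_var monI truncI).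
have var_inj i j k : 'X_k \in P i -> 'X_k \in P j -> i = j.
  move=> ki kj; apply/eqP; apply: contraT => /disjointP/(_ U_(k)%MM)[].
  by split; apply: prime_ideal_var_gen.
(* [Zs] is the family of the variable sets of the corners. *)
pose Zs := [set [set k | box_mnm c k < N] |
  c : {ffun 'I_n -> 'I_N.+1} & corner I N (box_mnm c)].
have ZsP b : corner I N b -> [set k | b k < N] \in Zs.
  by move=> cb; have [c Ec] := corner_box cb; rewrite -Ec imset_f // inE Ec.
have tiZ : trivIset Zs.
  apply/trivIsetP => _ _ /imsetP[c + ->] /imsetP[d + ->]; rewrite !inE.
  move=> /corner_ass[i Hi] /corner_ass[j Hj]; apply: contraR.
  move=> /pred0Pn[k /andP[]]; rewrite !inE -Hi -Hj => ki kj; apply/eqP/setP => l.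
  by rewrite !inE -Hi -Hj (var_inj i j k).
have nz0 : set0 \notin Zs.
  apply/imsetP => -[c]; rewrite inE => cb /setP Z0.
  suff : 'X_[a0] \notin I by rewrite a0I.
  by apply: (corner_below monI truncI cb) => k ck; have := Z0 k; rewrite !inE ck.
have [pi [piK free_block Zs_block]] := block_retraction tiZ nz0.
have corner_block b : corner I N b -> exists t,
    [/\ t \in cover Zs, pi t = t & forall k, (b k < N) = (pi k == t)].
  move=> /ZsP bZ; have [t [tZ pit Zt]] := Zs_block _ bZ.
  exists t; split=> // [|k]; last by rewrite -Zt inE.
  by apply/bigcupP; exists [set k | b k < N].
have block_corner k : k \in cover Zs ->
    exists2 b, corner I N b & forall j, (b j < N) = (pi j == pi k).
  move=> /bigcupP[Z ZZ kZ]; have [t [_ _ Zt]] := Zs_block Z ZZ.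
  move: (kZ); rewrite Zt => /eqP->; case/imsetP: ZZ Zt => c; rewrite inE => cb -> Zt.
  by exists (box_mnm c) => // j; rewrite -Zt inE.
have le_T := sdepth_bound monI truncI corner_block.
split.
  apply: enat_le_trans le_T; rewrite /= -[m]card_ord.
  have /fin_all_exists[f Hf] i : exists k, (pi k = k) /\ 'X_k \in P i.
    (* The monomial with exponent [N] along the transversal escapes all corners. *)
    pose a := [multinom if pi k == k then N else 0 | k < n].
    have /(prime_ideal_mpolyX (primeP i))[k] : 'X_[a] \in P i.
      have [_ [f ->]] := assP i; rewrite mulrC; apply: (submodM subI).
      apply/negPn/negP => /(corner_above truncI)[b cb le_ab].
      have [t [_ pit bt]] := corner_block b cb.
      have := le_ab t; rewrite bt mnmE pit eqxx => /(_ isT).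
      by rewrite leqNgt bt pit eqxx.
    by rewrite mnmE; case: eqP => // pik _ kP; exists k.
  have f_inj : injective f.
    move=> i j eq_f; have [[_ fi] [_ fj]] := (Hf i, Hf j).
    by apply: var_inj fi _; rewrite eq_f.
  rewrite -(card_imset _ f_inj); apply: subset_leq_card.
  by apply/subsetP => _ /imsetP[i _ ->]; rewrite inE; have [->] := Hf i.
apply: enat_le_trans le_T; apply: depth_le => // fs reg.
exact: (regular_sequence_bound monI truncI piK free_block block_corner corner_block).
Qed.
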